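(* For every graph $G$, \[ \operatorname{cw}(G) \leq \operatorname{lcw}(G) \leq \operatorname{tcpw}(G) + 3 \leq \operatorname{tctd}(G) + 2 \leq \operatorname{td}(G) + 2. \]
   Context: Clique-expressions build labeled graphs from: introduce (single vertex with label $i$), disjoint union, relabel (all labels $i$ become $j$), and join (add all edges between labels $i \neq j$). A $k$-expression uses at most $k$ labels in every intermediate graph. $\operatorname{cw}(G)$ is the minimum $k$ such that some $k$-expression constructs $G$ (up to forgetting labels); a clique-expression is linear if in every union the second operand is a single vertex, and $\operatorname{lcw}(G)$ is the minimum $k$ over linear $k$-expressions. Two vertices $u,v$ are twins if $N(u)\setminus\{v\} = N(v)\setminus\{u\}$; $\Pi_{tc}(G)$ is the partition into twinclasses; the quotient graph $G/\Pi_{tc}(G)$ has the twinclasses as vertices, adjacent iff some of their vertices are adjacent in $G$. $\operatorname{tcpw}(G) = \operatorname{pw}(G/\Pi_{tc}(G))$ and $\operatorname{tctd}(G) = \operatorname{td}(G/\Pi_{tc}(G))$, where $\operatorname{pw}$ is pathwidth and $\operatorname{td}$ is treedepth (minimum depth of a rooted forest on the vertex set in which every edge joins an ancestor–descendant pair). *)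

(* Defs.v *)
From HB Require Import structures.
From mathcomp Require Import all_boot all_order all_algebra.
From mathcomp Require Import boolp.

Set Implicit Arguments.
Unset Strict Implicit.
Unset Printing Implicit Defensive.

(* [least P] is 0 when no natural number satisfies [P]. *)
Definition least (P : nat -> Prop) : nat :=
  if pselect (exists n, `[< P n >]) is left exP then ex_minn exP else 0.

Lemma leastP (P : nat -> Prop) :
  (exists n, P n) -> P (least P) /\ forall m, P m -> least P <= m.
Proof.
move=> [n Pn]; rewrite /least; case: pselect => [exP|[]]; last first.
  by exists n; apply/asboolP.
by case: ex_minnP => m /asboolP Pm min_m; split=> // j Pj; apply/min_m/asboolP.
Qed.

Record sgraph := SGraph {
  vertex :> finType;
  adj : rel vertex;
  adj_sym : symmetric adj;
  adj_irrefl : irreflexive adj }.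

Record lgraph := LGraph {
  lgraph_graph :> sgraph;
  lab : lgraph_graph -> nat }.

Definition single_adj : rel unit := fun _ _ => false.
Lemma single_adj_sym : symmetric single_adj. Proof. by []. Qed.
Lemma single_adj_irrefl : irreflexive single_adj. Proof. by []. Qed.

Definition introduce_lgraph (i : nat) : lgraph :=
  LGraph (lgraph_graph := SGraph single_adj_sym single_adj_irrefl) (fun=> i).

Section Union.
Variables A B : lgraph.
Definition union_adj : rel (A + B) := fun x y =>
  match x, y with
  | inl a, inl a' => adj a a'
  | inr b, inr b' => adj b b'
  | _, _ => false
  end.
Lemma union_adj_sym : symmetric union_adj.
Proof. by move=> [x|x] [y|y] //=; apply: adj_sym. Qed.
Lemma union_adj_irrefl : irreflexive union_adj.
Proof. by move=> [x|x] /=; apply: adj_irrefl. Qed.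
Definition union_lgraph : lgraph :=
  LGraph (lgraph_graph := SGraph union_adj_sym union_adj_irrefl)
    (fun x => match x with inl a => lab a | inr b => lab b end).
End Union.

Definition relabel_lgraph (i j : nat) (A : lgraph) : lgraph :=
  LGraph (lgraph_graph := A) (fun x => if lab x == i then j else lab x).

Section Join.
Variables (i j : nat) (ij : i != j) (A : lgraph).
Definition join_adj : rel A := fun x y =>
  [|| adj x y, (lab x == i) && (lab y == j) | (lab x == j) && (lab y == i)].
Lemma join_adj_sym : symmetric join_adj.
Proof.
by move=> x y; rewrite /join_adj adj_sym ![_ && (lab y == _)]andbC [X in _ || X]orbC.
Qed.
Lemma join_adj_irrefl : irreflexive join_adj.
Proof.
move=> x; rewrite /join_adj adj_irrefl /= [X in _ || X]andbC orbb.
by apply: contraNF ij => /andP[/eqP <- /eqP <-].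
Qed.
Definition join_lgraph : lgraph :=
  LGraph (lgraph_graph := SGraph join_adj_sym join_adj_irrefl) (@lab A).
End Join.

Inductive cexpr : Type :=
  | Introduce of nat
  | Union of cexpr & cexpr
  | Relabel of nat & nat & cexpr
  | Join (i j : nat) of i != j & cexpr.

Fixpoint eval (e : cexpr) : lgraph :=
  match e with
  | Introduce i => introduce_lgraph i
  | Union e1 e2 => union_lgraph (eval e1) (eval e2)
  | Relabel i j e1 => relabel_lgraph i j (eval e1)
  | Join i j ij e1 => join_lgraph ij (eval e1)
  end.

Definition nb_labels (A : lgraph) : nat := size (undup (codom (@lab A))).

Fixpoint k_expression (k : nat) (e : cexpr) : bool :=
  (nb_labels (eval e) <= k) &&
  match e with
  | Introduce _ => true
  | Union e1 e2 => k_expression k e1 && k_expression k e2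
  | Relabel _ _ e1 | Join _ _ _ e1 => k_expression k e1
  end.

Fixpoint linear_expression (e : cexpr) : bool :=
  match e with
  | Introduce _ => true
  | Union e1 e2 =>
    [&& linear_expression e1, linear_expression e2 & #|eval e2| == 1]
  | Relabel _ _ e1 | Join _ _ _ e1 => linear_expression e1
  end.

Definition isomorphic (G H : sgraph) : Prop :=
  exists2 f : G -> H, bijective f & forall x y, adj (f x) (f y) = adj x y.

Definition constructs (e : cexpr) (G : sgraph) : Prop := isomorphic (eval e) G.

(* No clique-expression constructs the graph without vertices, for which
   [cw] and [lcw] are 0. *)
Definition cw (G : sgraph) : nat :=
  least (fun k => exists2 e, k_expression k e & constructs e G).

Definition lcw (G : sgraph) : nat :=
  least (fun k => exists e,
    [/\ k_expression k e, linear_expression e & constructs e G]).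

Definition nbh (G : sgraph) (u : G) : {set G} := [set v | adj u v].

Definition twins (G : sgraph) : rel G :=
  fun u v => nbh u :\ v == nbh v :\ u.

Definition twinclasses (G : sgraph) : {set {set G}} :=
  equivalence_partition (@twins G) [set: G].

Section Quotient.
Variables (G : sgraph) (P : {set {set G}}).
(* Distinctness is required because adjacent vertices may share a block. *)
Definition quotient_adj : rel {X : {set G} | X \in P} := fun X Y =>
  (X != Y) && [exists u in val X, exists v in val Y, adj u v].
Lemma quotient_adj_sym : symmetric quotient_adj.
Proof.
have S X Y : quotient_adj X Y -> quotient_adj Y X.
  case/andP=> XY /exists_inP[u uX /exists_inP[v vY uv]].
  rewrite /quotient_adj eq_sym XY; apply/exists_inP; exists v => //.
  by apply/exists_inP; exists u => //; rewrite adj_sym.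
by move=> X Y; apply/idP/idP; apply: S.
Qed.
Lemma quotient_adj_irrefl : irreflexive quotient_adj.
Proof. by move=> X; rewrite /quotient_adj eqxx. Qed.
Definition quotient_graph : sgraph :=
  SGraph quotient_adj_sym quotient_adj_irrefl.
End Quotient.

Definition path_decomposition (G : sgraph) (B : seq {set G}) : Prop :=
  [/\ forall v : G, exists2 b, b \in B & v \in b,
      forall u v : G, adj u v -> exists b, [/\ b \in B, u \in b & v \in b]
    & forall i j k, i <= j -> j <= k -> k < size B ->
        nth set0 B i :&: nth set0 B k \subset nth set0 B j].

(* Integer-valued: the graph without vertices has pathwidth -1. *)
Definition pw (G : sgraph) : int :=
  ((least (fun s => exists2 B : seq {set G},
      path_decomposition B & s = \max_(b <- B) #|b|))%:Z - 1)%R.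

(* A rooted forest is given by its parent function, roots having parent
   [None]. *)
Definition parent_rel (T : finType) (p : T -> option T) : rel T :=
  fun v u => p v == Some u.

Definition ancestor (T : finType) (p : T -> option T) (u v : T) : bool :=
  connect (parent_rel p) v u.

Definition rooted_forest (T : finType) (p : T -> option T) : Prop :=
  forall u v, p v = Some u -> ~~ ancestor p v u.

(* The ancestors of [v], itself included, are the vertices on the path from
   [v] to its root, so a single vertex has depth 1. *)
Definition forest_depth (T : finType) (p : T -> option T) : nat :=
  \max_(v : T) #|[set u | ancestor p u v]|.

Definition td (G : sgraph) : nat :=
  least (fun d => exists p : G -> option G,
    [/\ rooted_forest p,
        forall u v : G, adj u v -> ancestor p u v || ancestor p v u
      & d = forest_depth p]).

Definition tcpw (G : sgraph) : int := pw (quotient_graph (twinclasses G)).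

Definition tctd (G : sgraph) : nat := td (quotient_graph (twinclasses G)).

(* Main.v *)
Require Import Defs.
From mathcomp Require Import all_boot all_order all_algebra.
From mathcomp Require boolp.

(** Along a path decomposition of the quotient graph into bags of size at most
    [s], [s] labels distinguish the twinclasses of the current bag, one label
    collects the vertices whose class has been left behind, and one is
    reserved for the vertex being inserted; twins have equal adjacency to any
    new vertex, so joins with whole label classes suffice.  For
    [pw <= td - 1], the bags are the sets of ancestors of the vertices, listed
    in depth-first order, that is, in lexicographic order of the root paths.  Finally,
    choosing representatives embeds the quotient graph in [G], and restricting
    the ancestor order of a forest to a subset of the vertices gives again the
    ancestor order of a forest. *)

Set Implicit Arguments.
Unset Strict Implicit.
Unset Printing Implicit Defensive.

(** * Twins and twinclasses *)

Lemma twinsP (G : sgraph) (u v : G) :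
  reflect (forall x, x != u -> x != v -> adj u x = adj v x) (twins u v).
Proof.
apply: (iffP eqP) => [/setP uv x xu xv|uv].
  by have := uv x; rewrite !inE xu xv.
apply/setP=> x; rewrite !inE.
have [->|xu] := eqVneq x u; first by rewrite adj_irrefl andbF.
have [->|xv] /= := eqVneq x v; first by rewrite adj_irrefl.
exact: uv.
Qed.

Lemma twins_equivalence (G : sgraph) :
  {in [set: G] & &, equivalence_rel (@twins G)}.
Proof.
have sym (u v : G) : twins u v -> twins v u.
  by move=> /twinsP uv; apply/twinsP=> x xv xu; rewrite uv.
have trans (v u w : G) : twins u v -> twins v w -> twins u w.
  move=> /twinsP uv /twinsP vw; apply/twinsP=> x xu xw.
  have [xv|xv] := eqVneq x v; last by rewrite uv // vw.
  (* The middle vertex [v] is exempt from both twin conditions, so the equality goes through the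
     pair [u], [w]: [adj v u] is [adj w u], and [adj u w] is [adj v w]. *)
  have [-> //|uw] := eqVneq u w; subst x.
  rewrite adj_sym vw // 1?eq_sym // adj_sym uv // 1?eq_sym //.
  by rewrite adj_sym.
move=> u v w _ _ _; split=> [|uv]; first by rewrite /twins eqxx.
by apply/idP/idP; apply: trans => //; apply: sym.
Qed.

Section TwinClasses.
Variable G : sgraph.
Local Notation Q := (quotient_graph (twinclasses G)).

Lemma twinclasses_partition : partition (twinclasses G) [set: G].
Proof. exact/equivalence_partitionP/twins_equivalence. Qed.

Lemma mem_twinclass_unique (X Y : Q) (u : G) :
  u \in val X -> u \in val Y -> X = Y.
Proof.
move=> uX uY; apply: val_inj.
case/and3P: twinclasses_partition => _ triv _.
by rewrite -(def_pblock triv (valP X) uX) (def_pblock triv (valP Y) uY).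
Qed.

Lemma mem_twinclass_twins (X : Q) (u v : G) :
  u \in val X -> v \in val X -> twins u v.
Proof.
move=> uX vX; have [_ triv _] := and3P twinclasses_partition.
have := pblock_equivalence_partition (@twins_equivalence G)
  (in_setT u) (in_setT v).
by rewrite -/(twinclasses G) (def_pblock triv (valP X) uX) vX => <-.
Qed.

Lemma twinclass_exists (u : G) : exists X : Q, u \in val X.
Proof.
have [/eqP cov _ _] := and3P twinclasses_partition.
have ucov : u \in cover (twinclasses G) by rewrite cov.
by exists (Sub (pblock (twinclasses G) u) (pblock_mem ucov)); rewrite SubK mem_pblock.
Qed.

Lemma twinclass_inhabited (X : Q) : exists u, u \in val X.
Proof.
have [_ _ n0] := and3P twinclasses_partition.
by apply/set0Pn; apply: contraNneq n0 => <-; apply: valP.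
Qed.

(** An edge survives when its endpoints are exchanged for twins one at a time; since [X] and [Y] are
    disjoint, the other endpoint is never one of the two twins, whose mutual adjacency the twin
    condition ignores. *)
Lemma adj_twinclasses (X Y : Q) (u v : G) :
  adj X Y -> u \in val X -> v \in val Y -> adj u v.
Proof.
case/andP=> XY /exists_inP[x xX /exists_inP[y yY xy]] uX vY.
have disj a b : a \in val X -> b \in val Y -> a != b.
  move=> aX bY; apply: contraNneq XY => ab; subst b.
  by rewrite (mem_twinclass_unique aX bY).
have /twinsP -> := mem_twinclass_twins uX xX; try by rewrite eq_sym disj.
rewrite adj_sym; have /twinsP -> := mem_twinclass_twins vY yY;
  try by rewrite disj.
by rewrite adj_sym.
Qed.

End TwinClasses.

(** * Rooted forests and their ancestor orders *)

Section OrderForest.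
Variables (T : finType) (a : rel T).
Hypotheses (a_refl : reflexive a) (a_anti : antisymmetric a)
  (a_trans : transitive a)
  (a_chain : forall u v w, a u w -> a v w -> a u v || a v u).

(** The parent of [v] is its greatest strict predecessor; it exists as soon as [v] has a strict
    predecessor, because these form a finite chain. *)
Lemma order_forest : exists2 p : T -> option T,
  rooted_forest p & ancestor p =2 a.
Proof.
pose P v := [pred u | [&& a u v, u != v &
  [forall w, (a w v && (w != v)) ==> a w u]]].
pose p v := [pick u | P v u].
have pP u v : p v = Some u -> P v u by rewrite /p; case: pickP => // x Px [<-].
have p_a u v : ancestor p u v -> a u v.
  case/connectP=> s; elim: s v => [|w s IH] v /=; first by move=> _ ->.
  case/andP=> /eqP /pP /and3P[wv _ _] /IH uw /uw uw'; exact: a_trans uw' wv.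
have card_lt u v : a u v -> u != v ->
    #|[set w | a w u]| < #|[set w | a w v]|.
  move=> uv nuv; apply/proper_card/properP; split.
    by apply/subsetP=> w; rewrite !inE => /a_trans; apply.
  exists v; rewrite !inE //; apply: contraNN nuv => vu.
  by apply/eqP/a_anti; rewrite uv.
have a_p u v : a u v -> ancestor p u v.
  have [n] := ubnP #|[set w | a w v]|; elim: n v => // n IH v le_n uv.
  have [->|nuv] := eqVneq u v; first exact: connect0.
  have [w Pw] : exists w, P v w.
    have Pu : a u v && (u != v) by rewrite uv.
    (* A strict predecessor of [v] with the most predecessors is the greatest one: any other is
       comparable to it and, if above it, would have more. *)
    case: (@arg_maxnP _ u (fun w => a w v && (w != v))
      (fun w => #|[set x | a x w]|) Pu) => w /andP[wv nwv] max_w.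
    exists w; rewrite /= wv nwv; apply/forallP=> x; apply/implyP=> Px.
    have /andP[xv _] := Px; have := max_w x Px; rewrite /= leqNgt.
    case/orP: (a_chain xv wv) => // wx; have [-> //|nwx] := eqVneq w x.
    by rewrite card_lt.
  rewrite /ancestor; case Epv: (p v) => [w'|]; last first.
    by move: Epv; rewrite /p; case: pickP => // /(_ w); rewrite Pw.
  have /and3P[w'v nw'v /forallP/(_ u)] := pP _ _ Epv.
  rewrite uv nuv /= => uw'.
  apply: (@connect_trans _ _ w'); first by apply: connect1; apply/eqP.
  by apply: IH => //; apply: leq_trans (card_lt _ _ w'v nw'v) _.
exists p => [u v /pP /and3P[vu nvu _]|u v]; last first.
  by apply/idP/idP; [apply: p_a | apply: a_p].
by apply: contraNN nvu => /p_a uv; apply/eqP/a_anti; rewrite vu uv.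
Qed.

End OrderForest.

Section ForestOrder.
Variables (T : finType) (p : T -> option T).
Hypothesis p_forest : rooted_forest p.

Lemma ancestor_refl : reflexive (ancestor p).
Proof. by move=> u; apply: connect0. Qed.

Lemma ancestor_trans : transitive (ancestor p).
Proof. by move=> v u w uv vw; apply: connect_trans vw uv. Qed.

Lemma ancestorE (u v : T) :
  ancestor p u v = (u == v) || oapp (ancestor p u) false (p v).
Proof.
apply/idP/orP=> [/connectP[[|w s]]|[/eqP ->|]] /=.
- by move=> _ ->; left.
- by case/andP=> /eqP -> ws ->; right; apply/connectP; exists s.
- exact: connect0.
case pv: (p v) => [w|] //= uw.
by apply: connect_trans uw; apply: connect1; apply/eqP.
Qed.

Lemma ancestor_anti : antisymmetric (ancestor p).
Proof.
move=> u v /andP[]; rewrite ancestorE => /orP[/eqP //|].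
case pv: (p v) => [w|] //= uw vu.
by have := p_forest pv; rewrite (ancestor_trans vu uw).
Qed.

Lemma ancestor_chain (u v w : T) :
  ancestor p u w -> ancestor p v w -> ancestor p u v || ancestor p v u.
Proof.
move=> /connectP[s]; elim: s w => [|x s IH] w /=.
  by move=> _ -> ->; rewrite orbT.
case/andP=> /eqP wx xs us vw.
have uw : ancestor p u w.
  by apply/connectP; exists (x :: s) => //=; rewrite xs andbT; apply/eqP.
move: vw; rewrite ancestorE wx /= => /orP[/eqP ->|]; first by rewrite uw.
exact: IH.
Qed.

(** Provides the measure for inductions along parents, which also bounds the recursion computing
    root paths. *)
Lemma parent_card (u v : T) : p v = Some u ->
  #|[set w | ancestor p w u]| < #|[set w | ancestor p w v]|.
Proof.
move=> pv; have uv : ancestor p u v by apply: connect1; apply/eqP.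
apply/proper_card/properP; split.
  by apply/subsetP=> w; rewrite !inE => /ancestor_trans; apply.
by exists v; rewrite !inE ?ancestor_refl // p_forest.
Qed.

End ForestOrder.

(** * Treedepth and its monotonicity under embeddings *)

Lemma td_attained (G : sgraph) : exists p : G -> option G,
  [/\ rooted_forest p,
      forall u v : G, adj u v -> ancestor p u v || ancestor p v u
    & td G = forest_depth p].
Proof.
(* A total order of the vertices gives a path-shaped forest, valid for every graph, so [least] does
   not fall back on its default. *)
have [||||p pf pa] := @order_forest G (fun u v => enum_rank u <= enum_rank v).
- by move=> u /=.
- by move=> u v uv; apply/enum_rank_inj/val_inj/anti_leq.
- by move=> u v w; apply: leq_trans.
- by move=> u v w _ _; apply: leq_total.
rewrite /td; set P := (X in least X).
have /leastP[[q [qf qa eq_q]] _] : exists d, P d.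
  by exists (forest_depth p), p; split=> // u v _; rewrite !pa leq_total.
by exists q.
Qed.

Lemma td_le (G : sgraph) (p : G -> option G) :
  rooted_forest p ->
  (forall u v : G, adj u v -> ancestor p u v || ancestor p v u) ->
  td G <= forest_depth p.
Proof.
move=> pf pa; rewrite /td; set P := (X in least X).
have Pp : P (forest_depth p) by exists p.
by have /leastP[_] : exists d, P d; [exists (forest_depth p) | apply].
Qed.

Lemma td_embedding (G H : sgraph) (f : H -> G) :
  injective f -> {homo f : x y / adj x y} -> td H <= td G.
Proof.
move=> f_inj f_adj; have [p [pf pa ->]] := td_attained G.
have [||||q qf qa] := @order_forest H (fun x y => ancestor p (f x) (f y)).
- by move=> x; apply: ancestor_refl.
- by move=> x y xy; apply/f_inj/(ancestor_anti pf).
- by move=> x y z; apply: ancestor_trans.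
- by move=> x y z; apply: ancestor_chain.
have le_td : td H <= forest_depth q.
  by apply: td_le => // x y /f_adj /pa; rewrite !qa.
apply: leq_trans le_td _; apply/bigmax_leqP=> x _.
(* The depth does not grow: [f] sends the ancestors of [x] injectively to ancestors of [f x]. *)
apply: leq_trans (leq_bigmax (f x)); rewrite -(card_imset _ f_inj).
by apply/subset_leq_card/subsetP=> _ /imsetP[y + ->]; rewrite !inE qa.
Qed.

Lemma tctd_le_td (G : sgraph) : tctd G <= td G.
Proof.
have [f fP] := fin_all_exists (@twinclass_inhabited G).
apply: (@td_embedding G _ f) => [X Y eXY|X Y XY].
  by apply: (mem_twinclass_unique (fP X)); rewrite eXY.
exact: adj_twinclasses XY (fP X) (fP Y).
Qed.

(** * Root paths, depth-first order, and pathwidth against treedepth *)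

Lemma prefix_rconsr (T : eqType) (s t : seq T) (x : T) :
  prefix s (rcons t x) = (s == rcons t x) || prefix s t.
Proof.
elim: t s => [|y t IH] [|z s] //=; first by rewrite eqseq_cons orbF; case: s.
by rewrite eqseq_cons IH; case: eqP.
Qed.

Section LexPath.
Variables (T : finType) (p : T -> option T).
Hypothesis p_forest : rooted_forest p.

(** The codes of the vertices from the root down to [v]. The fuel [n] suffices once it reaches the
    number of ancestors of [v], which is at most [#|T|]. *)
Fixpoint root_path_rec (n : nat) (v : T) : seq nat :=
  if n is m.+1 then rcons (oapp (root_path_rec m) [::] (p v)) (pickle v)
  else [::].

Definition root_path (v : T) : seqlexi nat := root_path_rec #|T| v.

Lemma root_path_rcons (v : T) :
  root_path v = rcons (oapp root_path [::] (p v)) (pickle v).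
Proof.
have stable n w : #|[set u | ancestor p u w]| <= n ->
    root_path_rec n w = root_path_rec n.+1 w.
  elim: n w => [|n IH] w.
    rewrite leqn0 cards_eq0 => /eqP /setP /(_ w).
    by rewrite !inE ancestor_refl.
  move=> le_n /=; case pw: (p w) => [u|] //=; congr rcons; apply: IH.
  by rewrite -ltnS (leq_trans (parent_card p_forest pw)).
by rewrite {1}/root_path stable ?max_card.
Qed.

Lemma root_path_inj : injective root_path.
Proof.
move=> u v; rewrite !root_path_rcons => /rcons_inj[_].
exact: (pcan_inj pickleK).
Qed.

(** Both sides obey the same recursion along parents, by [ancestorE] and [prefix_rconsr]. *)
Lemma prefix_root_path (u v : T) :
  prefix (root_path u) (root_path v) = ancestor p u v.
Proof.
have [n] := ubnP #|[set w | ancestor p w v]|; elim: n v => // n IH v le_n.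
rewrite ancestorE.
have -> : prefix (root_path u) (root_path v) = (u == v) ||
    oapp (fun w => prefix (root_path u) (root_path w)) false (p v).
  rewrite -(inj_eq root_path_inj) [root_path v]root_path_rcons.
  rewrite prefix_rconsr; case: (p v) => [w|] //=.
  (* For a root [v] the remaining word is empty, and the nonempty [root_path u] is no prefix of
     it. *)
  by rewrite root_path_rcons; case: (oapp _ _ _).
case pv: (p v) => [w|] //=; rewrite IH //.
by apply: leq_trans (parent_card p_forest pv) _.
Qed.

(** The first letter of [b] is squeezed between equal letters, and so on along [s]. For root paths,
    the descendants of a vertex are therefore consecutive in the sorted list, which is the convexity
    of the bags. *)
Lemma prefix_lexi_convex (s a b c : seqlexi nat) :
  prefix s a -> prefix s c -> (a <= b)%O -> (b <= c)%O -> prefix s b.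
Proof.
elim: s a b c => [|x s IH] [|y a] [|z b] [|t c] //=.
case/andP=> /eqP <- sa /andP[/eqP <- sc].
rewrite !Order.SeqLexiOrder.lexi_cons => /andP[xz xza] /andP[zx zxc].
have exz : x = z by apply/Order.POrderTheory.le_anti; rewrite xz.
subst z; rewrite eqxx /=.
by apply: IH sa sc _ _; [move/implyP: xza | move/implyP: zxc]; apply.
Qed.

End LexPath.

(** The [+ 1] cancels the [- 1] in [pw], leaving bag sizes; the largest bag [anc v] has exactly the
    forest depth as its size. *)
Lemma pw_td (G : sgraph) : (pw G + 1 <= (td G)%:Z)%R.
Proof.
have [p [pf pa ->]] := td_attained G.
pose anc v := [set u | ancestor p u v].
pose le : rel G := fun u v => (root_path p u <= root_path p v)%O.
have le_tot : total le by move=> u v; apply: Order.TotalTheory.le_total.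
have le_tr : transitive le by move=> u v w; apply: Order.POrderTheory.le_trans.
pose s := sort le (enum G).
have s_all v : v \in s by rewrite mem_sort mem_enum.
rewrite /pw GRing.subrK lez_nat; set P := (X in least X).
suff Pp : P (forest_depth p).
  by have /leastP[_] : exists n, P n; [exists (forest_depth p) | apply].
exists [seq anc v | v <- s]; last first.
  by rewrite big_map /forest_depth (perm_big _ (permEl (perm_sort _ _))) big_enum.
split=> [v|u v uv|i j k ij jk].
- by exists (anc v); rewrite ?map_f // inE ancestor_refl.
(* The bag of the lower endpoint contains both endpoints. *)
- case/orP: (pa _ _ uv) => H; [exists (anc v) | exists (anc u)].
    by rewrite map_f // !inE ancestor_refl.
  by rewrite map_f // !inE ancestor_refl.
rewrite size_map => ks; have js := leq_ltn_trans jk ks.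
have is_ := leq_ltn_trans ij js.
have srt : sorted le s := sort_sorted le_tot _.
have /card_gt0P[x0 _] : 0 < #|G|.
  by apply: leq_ltn_trans (leq0n k) _; rewrite cardT -(size_sort le).
rewrite !(nth_map x0) //; apply/subsetP=> u; rewrite !inE.
rewrite -!(prefix_root_path pf) => /andP[ui uk].
by apply: (prefix_lexi_convex ui uk);
  apply: (sorted_leq_nth le_tr (fun v => Order.POrderTheory.lexx _) x0 srt).
Qed.

(** * Linear expressions building parts of a fixed graph *)

Section Builds.
Variable G : sgraph.
Implicit Types (X : {set G}) (E : rel G) (l : G -> nat).

(** The injection [f] names the vertices of [eval e] by those of [G], so that edges and labels
    become functions on [G] that matter only on [X]. [E] is separate from [adj] to describe graphs
    whose joins are still incomplete. *)
Definition builds (k : nat) X E l : Prop :=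
  {in X, forall x, l x < k} /\
  exists e, [/\ k_expression k e, linear_expression e &
    exists f : eval e -> G, [/\ injective f, codom f =i X,
      forall x y, adj x y = E (f x) (f y) & forall x, lab x = l (f x)]].

Lemma nb_labels_le (A : lgraph) (k : nat) :
  (forall x : A, lab x < k) -> nb_labels A <= k.
Proof.
move=> lt_k; rewrite /nb_labels -[leqRHS](size_iota 0).
apply: uniq_leq_size (undup_uniq _) _ => i.
by rewrite mem_undup mem_iota => /codomP[x ->] /=.
Qed.

Lemma builds_ext k X E E' l l' :
  {in X &, E =2 E'} -> {in X, l =1 l'} -> builds k X E l -> builds k X E' l'.
Proof.
move=> EE' ll' [lk [e [ke le [f [f_inj fX fE fl]]]]].
have Xf x : f x \in X by rewrite -fX codom_f.
split=> [x xX|]; first by rewrite -ll' ?lk.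
exists e; split=> //; exists f; split=> // [x y|x].
  by rewrite fE EE'.
by rewrite fl ll'.
Qed.

Lemma builds_set1 k v E l :
  E v v = false -> l v < k -> builds k [set v] E l.
Proof.
move=> Ev lv; split=> [x /set1P -> //|].
exists (Introduce (l v)); split=> //=.
  by rewrite andbT nb_labels_le.
exists (fun=> v); split=> //; first by case=> [] [].
by move=> x; rewrite in_set1; apply/codomP/eqP=> [[_ ->] //|->]; exists tt.
Qed.

Lemma builds_setU1 k X v E l :
  builds k X E l -> v \notin X -> l v < k -> E v v = false ->
  {in X, forall x, E v x = false /\ E x v = false} ->
  builds k (v |: X) E l.
Proof.
move=> [lk [e [ke le [f [f_inj fX fE fl]]]]] vX lv Ev EvX.
have Xf x : f x \in X by rewrite -fX codom_f.
have vf x : v != f x by apply: contraNneq vX => ->.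
split=> [x /setU1P[-> //|]|]; first exact: lk.
exists (Union e (Introduce (l v))); split=> /=.
- rewrite ke nb_labels_le ?nb_labels_le // => -[x|_] //=.
  by rewrite fl lk.
- by rewrite le card_unit.
pose g (z : eval e + unit) := if z is inl x then f x else v.
exists g; split.
- move=> [x|[]] [y|[]] //= exy.
  + by rewrite (f_inj _ _ exy).
  + by have := vf x; rewrite exy eqxx.
  + by have := vf y; rewrite exy eqxx.
- move=> x; rewrite in_setU1 -fX; apply/codomP/orP=> [[[y|[]] ->] /=|].
  + by right; apply: codom_f.
  + by left.
  + case=> [/eqP ->|/codomP[y ->]]; first by exists (inr tt).
    by exists (inl y).
- move=> [x|[]] [y|[]] //=.
  + by have [_ ->] := EvX _ (Xf x).
  + by have [-> _] := EvX _ (Xf y).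
- by case.
Qed.

Lemma builds_join k X E l i j : i != j -> builds k X E l ->
  builds k X (fun x y => [|| E x y, (l x == i) && (l y == j)
    | (l x == j) && (l y == i)]) l.
Proof.
move=> ij [lk [e [ke le [f [f_inj fX fE fl]]]]].
split=> //; exists (Join ij e); split=> //=.
  by rewrite ke nb_labels_le // => x /=; rewrite fl lk // -fX codom_f.
by exists f; split=> // x y /=; rewrite /join_adj /= fE !fl.
Qed.

Lemma builds_relabel k X E l i j : j < k -> builds k X E l ->
  builds k X E (fun x => if l x == i then j else l x).
Proof.
move=> jk [lk [e [ke le [f [f_inj fX fE fl]]]]].
split=> [x xX|]; first by case: ifP => // _; apply: lk.
exists (Relabel i j e); split=> //=.
  rewrite ke nb_labels_le // => x /=; case: ifP => // _.
  by rewrite fl lk // -fX codom_f.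
by exists f; split=> // x /=; rewrite fl.
Qed.

Lemma builds_relabel_seq k X E l (s : seq nat) j : j < k -> j \notin s ->
  builds k X E l -> builds k X E (fun x => if l x \in s then j else l x).
Proof.
move=> jk + B; elim: s => [|i s IH] /=; first by move=> _; apply: builds_ext B.
rewrite inE negb_or => /andP[ji js].
apply: builds_ext (builds_relabel i jk (IH js)) => // x xX /=.
rewrite inE; have [//|nxi] := boolP (l x \in s); last by rewrite orbF.
by rewrite (negPf ji) orbT.
Qed.

(* Joining requires a label of its own for the vertex being added, whence the
   extra label [k], which is free again afterwards. *)
Lemma builds_add_vertex k X l v c (J : pred nat) :
  builds k.+1 X (@adj G) l -> {in X, forall x, l x < k} ->
  v \notin X -> c < k ->
  {in X, forall x, adj v x = J (l x)} ->
  builds k.+1 (v |: X) (@adj G) (fun x => if x == v then c else l x).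
Proof.
move=> B lk vX ck vJ; pose l1 x := if x == v then k else l x.
have xv x : x \in X -> (x == v) = false by apply: contraTF => /eqP ->.
have l1k x : x \in v |: X -> (l1 x == k) = (x == v).
  rewrite /l1 => /setU1P[->|xX]; first by rewrite !eqxx.
  by rewrite xv // ltn_eqF ?lk.
(* The graph just after the union: [v] is isolated and is the only vertex labeled [k]. *)
pose E0 x y := [&& adj x y, x != v & y != v].
have B1 : builds k.+1 (v |: X) E0 l1.
  apply: builds_setU1 => //; first last.
  - by move=> x xX; rewrite /E0 eqxx !andbF.
  - by rewrite /E0 eqxx !andbF.
  - by rewrite /l1 eqxx.
  apply: builds_ext B => [x y xX yX|x xX]; last by rewrite /l1 xv.
  by rewrite /E0 !xv ?andbT.
(* The graph after joining label [k] with each label in [s], one join per label; taking for [s] the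
   labels below [k] in [J] gives exactly the edges at [v]. *)
pose E1 (s : seq nat) x y :=
  [|| E0 x y, (x == v) && (l1 y \in s) | (y == v) && (l1 x \in s)].
have B2 s : all (gtn k) s -> builds k.+1 (v |: X) (E1 s) l1.
  elim: s => [_|j s IH /andP[jk /IH Bs]].
    by apply: builds_ext B1 => // x y _ _; rewrite /E1 !andbF !orbF.
  have kj : k != j by rewrite gtn_eqF.
  apply: builds_ext (builds_join kj Bs) => // x y xX yX.
  rewrite /E1 !l1k // !inE.
  by case: (E0 x y); case: (x == v); case: (y == v); case: (l1 x == j);
    case: (l1 y == j); case: (l1 x \in s); case: (l1 y \in s).
have Js : all (gtn k) (filter J (iota 0 k)).
  by apply/allP=> i; rewrite mem_filter mem_iota => /andP[_ /andP[]].
have mem_J x : x \in X -> (l x \in filter J (iota 0 k)) = adj v x.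
  by move=> xX; rewrite mem_filter mem_iota (lk x xX) leq0n /= andbT -vJ.
have k_J : (k \in filter J (iota 0 k)) = false.
  by rewrite mem_filter mem_iota ltnn !andbF.
have B3 := builds_relabel k (leqW ck) (B2 _ Js).
apply: builds_ext B3 => [x y|x xX].
  rewrite /E1 /E0 /l1 => /setU1P[->|xX] /setU1P[->|yX].
  - by rewrite !eqxx k_J adj_irrefl.
  - by rewrite eqxx xv //= mem_J // orbF andbF.
  - by rewrite eqxx xv //= mem_J // andbF /= adj_sym.
  - by rewrite !xv // !andbT orbF.
by rewrite l1k // /l1; case: eqVneq.
Qed.

End Builds.

(** * Sweeping along a path decomposition of the classes *)

Lemma extend_coloring (T : finType) (A B : {set T}) (col : T -> nat) (s : nat) :
  A \subset B -> #|B| <= s -> {in A &, injective col} ->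
  {in A, forall x, col x < s} ->
  exists col', [/\ {in A, col' =1 col}, {in B &, injective col'}
    & {in B, forall x, col' x < s}].
Proof.
move=> + sB; have [n] := ubnP #|B :\: A|.
elim: n A col => // n IH A col le_n AB col_inj col_lt.
have [BA|/subsetPn[x xB xA]] := boolP (B \subset A).
  have eAB : A = B by apply/eqP; rewrite eqEsubset AB.
  by exists col; rewrite -eAB.
(* A color below [s] is free: otherwise all [s] colors would occur on [A], which has fewer elements
   than [B], hence fewer than [s]. *)
have [c cs cA] : exists2 c, c < s & forall y, y \in A -> col y != c.
  pose used := [seq col y | y <- enum A].
  have : ~~ all (mem used) (iota 0 s).
    apply/negP=> /allP sub; have := uniq_leq_size (iota_uniq 0 s) sub.
    rewrite size_iota size_map -cardE leqNgt => /negP[].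
    apply: leq_trans sB; apply: proper_card; apply/properP.
    by split=> //; exists x.
  case/allPn=> c; rewrite mem_iota => /= cs cu; exists c => // y yA.
  by apply: contraNneq cu => <-; apply: map_f; rewrite mem_enum.
pose col1 y := if y == x then c else col y.
have col1E y : y \in A -> col1 y = col y.
  by rewrite /col1; case: eqP => // ->; rewrite (negPf xA).
have col1x : col1 x = c by rewrite /col1 eqxx.
have [||||col' [col'E col'_inj col'_lt]] := IH (x |: A) col1.
- apply: leq_trans (_ : #|B :\: A| <= n) => //; apply/proper_card/properP.
  split; first by apply/setDS/subsetUr.
  by exists x; rewrite !inE ?xA ?xB ?eqxx.
- by apply/subsetP=> y /setU1P[->|/(subsetP AB)].
- move=> y z /setU1P[->|yA] /setU1P[->|zA] //; rewrite ?col1x ?col1E //.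
  + by move=> e; have := cA z zA; rewrite -e eqxx.
  + by move=> e; have := cA y yA; rewrite e eqxx.
  + exact: col_inj.
- by move=> y /setU1P[->|yA]; rewrite ?col1x ?col1E // col_lt.
exists col'; split=> // y yA; rewrite col'E ?col1E //.
by rewrite inE yA orbT.
Qed.

Section Decomposition.
Variables (G : sgraph) (T : finType) (cl : G -> T) (B : seq {set T}) (s : nat).
Hypotheses (cl_twins : forall u v, cl u = cl v -> twins u v)
  (B_cover : forall v, exists2 b, b \in B & cl v \in b)
  (B_edge : forall u v, adj u v ->
     exists b, [/\ b \in B, cl u \in b & cl v \in b])
  (B_convex : forall i j k, i <= j -> j <= k -> k < size B ->
     nth set0 B i :&: nth set0 B k \subset nth set0 B j)
  (B_size : {in B, forall b : {set T}, #|b| <= s}).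

Implicit Types (A b : {set T}) (X : {set G}) (col : T -> nat) (u v x : G).

Definition covered (i : nat) : {set G} :=
  [set v | has (fun b => cl v \in b) (take i B)].

(* Classes outside the current bag share the label [s]; the label [s.+1] is
   reserved for the vertex being added. *)
Definition bag_label A col v : nat :=
  if cl v \in A then col (cl v) else s.

(** The empty [X] is a case of its own because no expression evaluates to a graph without
    vertices. *)
Definition bag_state X A : Prop :=
  exists col, [/\ {in A &, injective col}, {in A, forall t, col t < s}
    & X = set0 \/ builds s.+2 X (@adj G) (bag_label A col)].

Lemma bag_label_lt A col v :
  {in A, forall t, col t < s} -> bag_label A col v < s.+1.
Proof. by move=> ltA; rewrite /bag_label; case: ifP => // /ltA /leqW. Qed.

(** Classes in both bags keep their labels, and those leaving [A] are relabeled to [s]. Classes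
    entering [b] have no vertex in [X] yet, so the freed labels can be given to them. *)
Lemma bag_state_next X A b : #|b| <= s -> bag_state X A ->
  {in X, forall x, cl x \in b -> cl x \in A} -> bag_state X b.
Proof.
move=> bs [col [col_inj col_lt BX]] XbA.
have sub_inj : {in A :&: b &, injective col}.
  by move=> t u /setIP[tA _] /setIP[uA _]; apply: col_inj.
have sub_lt : {in A :&: b, forall t, col t < s}.
  by move=> t /setIP[tA _]; apply: col_lt.
have [col' [col'E col'_inj col'_lt]] :=
  extend_coloring (subsetIr A b) bs sub_inj sub_lt.
exists col'; split=> //; case: BX => [|BX]; [by left | right].
pose S := [seq col t | t <- enum (A :\: b)].
have sS : s \notin S.
  apply/negP=> /mapP[t]; rewrite mem_enum => /setDP[/col_lt + _] es.
  by rewrite -es ltnn.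
apply: builds_ext (builds_relabel_seq (leqW (ltnSn s)) sS BX) => // x xX.
rewrite /bag_label; have [xb|xb] := boolP (cl x \in b).
  have xA := XbA x xX xb; rewrite xA col'E ?inE ?xA // ifN //.
  apply/negP=> /mapP[t]; rewrite mem_enum => /setDP[tA tb].
  by move/col_inj => /(_ xA tA) ext; rewrite -ext xb in tb.
have [xA|_] := boolP (cl x \in A); last by case: ifP.
by rewrite ifT // map_f // mem_enum inE xb.
Qed.

Lemma bag_state_add X A v : bag_state X A -> v \notin X -> cl v \in A ->
  {in X, forall x, adj v x -> cl x \in A} -> bag_state (v |: X) A.
Proof.
move=> [col [col_inj col_lt BX]] vX vA XA.
exists col; split=> //; right; case: BX => [->|BX].
  rewrite setU0; apply: builds_set1; first exact: adj_irrefl.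
  by rewrite leqW ?bag_label_lt.
(* The labels of the neighbors of [v] in [X]. Such neighbors have their class in [A], so the label
   determines the class and is never [s]; twins then agree on adjacency to [v]. *)
pose J : pred nat :=
  fun c => [exists x in X, adj v x && (bag_label A col x == c)].
have vJ : {in X, forall x, adj v x = J (bag_label A col x)}.
  move=> x xX; apply/idP/exists_inP=> [vx|[y yX /andP[vy /eqP]]].
    by exists x => //; rewrite vx eqxx.
  rewrite /bag_label XA //; have yA := XA y yX vy.
  case: ifP => [xA /col_inj|_ yxs]; last by have := col_lt _ yA; rewrite yxs ltnn.
  move=> /(_ yA xA) /cl_twins /twinsP yx; rewrite adj_sym -yx 1?adj_sym //.
    by apply: contraNneq vX => ->.
  by apply: contraNneq vX => ->.
have lab_lt : {in X, forall x, bag_label A col x < s.+1}.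
  by move=> x _; apply: bag_label_lt.
have := builds_add_vertex BX lab_lt vX (bag_label_lt v col_lt) vJ.
by apply: builds_ext => // x _; case: eqP => [->|].
Qed.

Lemma coveredP i v :
  reflect (exists2 j, j < minn i (size B) & cl v \in nth set0 B j)
    (v \in covered i).
Proof.
rewrite inE; apply: (iffP (has_nthP set0)); rewrite size_take_min => -[j ji].
  by rewrite nth_take; [exists j | apply: leq_trans ji (geq_minl _ _)].
by exists j; rewrite // nth_take //; apply: leq_trans ji (geq_minl _ _).
Qed.

Lemma bag_state_covered i : i < size B ->
  bag_state (covered i) (nth set0 B i) ->
  bag_state (covered i.+1) (nth set0 B i).
Proof.
move=> iB st; pose b := nth set0 B i.
have cov_next v : (v \in covered i.+1) = (v \in covered i) || (cl v \in b).
  by rewrite !inE (take_nth set0) // has_rcons orbC.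
(* The vertices are inserted one by one along [r]. *)
suff add (r : seq G) : {subset r <= covered i.+1} ->
    bag_state (covered i :|: [set v in r]) b.
  have := add (enum (covered i.+1)) => H.
  have <- : covered i :|: [set v in enum (covered i.+1)] = covered i.+1.
    apply/setP=> v; rewrite in_setU in_set mem_enum cov_next.
    by case: (v \in covered i).
  by apply: H => v; rewrite mem_enum.
elim: r => [_|v r IH r_cov].
  suff -> : covered i :|: [set v in [::]] = covered i by [].
  by apply/setP=> v; rewrite !inE orbF.
set X := covered i :|: [set v in r]; have stX : bag_state X b.
  by apply: IH => u ur; apply: r_cov; rewrite inE ur orbT.
have -> : covered i :|: [set u in v :: r] = v |: X.
  by apply/setP=> u; rewrite /X !inE orbCA.
have [vX|vX] := boolP (v \in X); first by rewrite (setUidPr _) // sub1set.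
have v_new : v \notin covered i by apply: contraNN vX => vi; rewrite inE vi.
have vb : cl v \in b.
  by have := r_cov v (mem_head _ _); rewrite cov_next (negPf v_new).
apply: bag_state_add => // x xX vx.
have : x \in covered i.+1.
  move: xX; rewrite in_setU in_set => /orP[xi|xr]; first by rewrite cov_next xi.
  by apply: r_cov; rewrite inE xr orbT.
rewrite cov_next => /orP[/coveredP[m]|//].
rewrite leq_min => /andP[mi mB] xm.
(* The edge lies in a bag [j], with [i <= j] because [v] is new; the class of [x] also occurs in a
   bag [m] before [i], so convexity puts it into bag [i]. *)
have [_ [/(nthP set0)[j jB <-] vj xj]] := B_edge vx.
have ij : i <= j.
  rewrite leqNgt; apply: contraNN v_new => ji.
  by apply/coveredP; exists j; rewrite // leq_min ji.
by apply: (subsetP (B_convex (ltnW mi) ij jB)); rewrite inE xm.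
Qed.

(** After [i] bags the current one has index [i - 1]; [set0] stands in before the first. *)
Lemma bag_state_all i : i <= size B ->
  bag_state (covered i) (if i is j.+1 then nth set0 B j else set0).
Proof.
elim: i => [_|i IH iB].
  exists (fun=> 0); split=> [t u|t|]; rewrite ?inE //; left.
  by apply/setP=> v; rewrite !inE take0.
apply: bag_state_covered => //.
apply: bag_state_next (IH (ltnW iB)) _; first by rewrite B_size ?mem_nth.
move=> x /coveredP[j]; rewrite leq_min => /andP[ji jB] xj xi.
(* A class met earlier that occurs in the next bag is also in the current one, by convexity. *)
case: i ji iB xi {IH} => //= i ji iB xi.
by apply: (subsetP (B_convex (ji : j <= i) (leqnSn i) iB)); rewrite inE xj.
Qed.

Lemma linear_expression_of_decomposition : 0 < #|G| ->
  exists e, [/\ k_expression s.+2 e, linear_expression e & constructs e G].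
Proof.
move=> G0; have [col [_ _ BX]] := bag_state_all (leqnn (size B)).
have cov v : v \in covered (size B).
  by rewrite inE take_size; apply/hasP; have [b] := B_cover v; exists b.
case: BX => [X0|[_ [e [ke le [f [f_inj fX fE _]]]]]].
  by have /card_gt0P[v _] := G0; have := cov v; rewrite X0 inE.
exists e; split=> //; exists f => //.
apply: inj_card_bij => //; rewrite -(card_codom f_inj).
by apply/subset_leq_card/subsetP=> v _; rewrite fX.
Qed.

End Decomposition.

(** * The graph without vertices, and the chain of inequalities *)

Lemma eval_inhabited e : inhabited (eval e).
Proof.
elim: e => [i|e1 [x] e2 _|//|//]; apply: inhabits; last exact: inl x.
exact: tt.
Qed.

Lemma cw_empty (G : sgraph) : #|G| = 0 -> cw G = 0.
Proof.
move=> G0; rewrite /cw /least; case: boolp.pselect => // exP.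
have [k /boolp.asboolP[e _ [f _ _]]] := exP.
have [x] := eval_inhabited e.
by have := fintype0 (f x) G0.
Qed.

Lemma lcw_empty (G : sgraph) : #|G| = 0 -> lcw G = 0.
Proof.
move=> G0; rewrite /lcw /least; case: boolp.pselect => // exP.
have [k /boolp.asboolP[e [_ _ [f _ _]]]] := exP.
have [x] := eval_inhabited e.
by have := fintype0 (f x) G0.
Qed.

(** The single bag of all vertices decomposes every graph, so the minimum is over a nonempty set. *)
Lemma pw_attained (G : sgraph) : exists2 B : seq {set G},
  path_decomposition B & (pw G + 1 = (\max_(b <- B) #|b|)%:Z)%R.
Proof.
rewrite /pw GRing.subrK; set P := (X in least X).
have /leastP[[B BP ->] _] : exists s, P s.
  exists #|G|, [:: [set: G]]; last by rewrite big_seq1 cardsT.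
  split=> [v|u v _|i j [|k] ij jk //= _]; try by exists [set: G]; rewrite ?inE.
  by move: jk; rewrite leqn0 => /eqP ->; apply: subsetIr.
by exists B.
Qed.

Lemma lcw_attained (G : sgraph) : 0 < #|G| ->
  (exists e, [/\ k_expression (lcw G) e, linear_expression e & constructs e G])
  /\ ((lcw G)%:Z <= tcpw G + 3)%R.
Proof.
move=> G0; have [B [B_cover B_edge B_convex] pwB] :=
  pw_attained (quotient_graph (twinclasses G)).
have [cl clP] := fin_all_exists (@twinclass_exists G).
pose s := \max_(b <- B) #|b|.
have [|v|u v uv||b bB|//|e eP] :=
  @linear_expression_of_decomposition G _ cl B s.
- move=> u v uv; apply: (mem_twinclass_twins (clP u)).
  by rewrite uv; apply: clP.
- exact: B_cover.
(* An edge inside a twinclass is no edge of the quotient, but any bag holding the class serves. *)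
- have [->|cuv] := eqVneq (cl u) (cl v).
    by have [b bB vb] := B_cover (cl v); exists b.
  apply: B_edge; rewrite /adj /= /quotient_adj cuv.
  by apply/exists_inP; exists u => //; apply/exists_inP; exists v.
- exact: B_convex.
- exact: (@leq_bigmax_seq _ B predT (fun b : {set _} => #|b|) b).
rewrite /lcw; set P := (X in least X).
have Ps : P s.+2 by exists e.
have /leastP[Pl min_l] : exists k, P k by exists s.+2.
(* The largest bag size [s] is [tcpw G + 1], so [s.+2] labels amount to [tcpw G + 3]. *)
split=> //; rewrite /tcpw -[3%R]/(1 + 2)%R GRing.addrA pwB.
by rewrite -PoszD lez_nat addn2; apply: min_l.
Qed.

Lemma cw_le_lcw (G : sgraph) : cw G <= lcw G.
Proof.
have [G0|] := posnP #|G|; first by rewrite cw_empty.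
case/lcw_attained=> -[e [ke _ eG]] _; rewrite /cw; set P := (X in least X).
have Pl : P (lcw G) by exists e.
by have /leastP[_] : exists k, P k; [exists (lcw G) | apply].
Qed.

Lemma lcw_le_tcpw (G : sgraph) : ((lcw G)%:Z <= tcpw G + 3)%R.
Proof.
have [G0|/lcw_attained[] //] := posnP #|G|.
(* Without vertices [lcw G] is [0], and [tcpw G + 1] is nonnegative, being a bag size. *)
have [B _ pwB] := pw_attained (quotient_graph (twinclasses G)).
by rewrite lcw_empty // /tcpw -[3%R]/(1 + 2)%R GRing.addrA pwB.
Qed.

Theorem theorem4p3 (G : sgraph) :
  [/\ (cw G <= lcw G)%N,
      ((lcw G)%:Z <= tcpw G + 3)%R,
      (tcpw G + 3 <= (tctd G)%:Z + 2)%R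
    & (tctd G + 2 <= td G + 2)%N].
Proof.
split; last by rewrite leq_add2r tctd_le_td.
- exact: cw_le_lcw.
- exact: lcw_le_tcpw.
by rewrite -[3%R]/(1 + 2)%R GRing.addrA Num.Theory.lerD2r pw_td.
Qed.
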